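(* Let $d\ge 1$ be a fixed integer. If $(a_n)_{n\ge 0}$ is a log-convex sequence of nonnegative real numbers, then the sequence $(c_n)_{n\ge 0}$ defined by $$c_n=\sum_{k=0}^{n}\left\langle {n\atop k}\right\rangle^{(d)}a_k$$ is also log-convex.
   Context: A sequence $(a_n)_{n\ge 0}$ of nonnegative real numbers is log-convex if $a_{n-1}a_{n+1}\ge a_n^2$ for all $n\ge 1$. For integers $n,k\ge 0$ the $d$-Hoggatt numbers are $$\left\langle {n\atop k}\right\rangle^{(d)}:=\prod_{j=0}^{d-1}\frac{\binom{n+j}{k}}{\binom{k+j}{k}}.$$ (They vanish when $k>n$.) *)

(* Defs.v *)
From mathcomp Require Import all_boot all_order all_algebra.
From mathcomp Require Import reals.

Set Implicit Arguments.
Unset Strict Implicit.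
Unset Printing Implicit Defensive.

Import Order.TTheory GRing.Theory Num.Theory.

Local Open Scope ring_scope.

Definition log_convex (R : realType) (a : nat -> R) : Prop :=
  (forall n : nat, 0 <= a n) /\
  (forall n : nat, (1 <= n)%N -> a n.-1 * a n.+1 >= a n ^+ 2).

Definition hoggatt (R : realType) (d n k : nat) : R :=
  \prod_(0 <= j < d) ('C(n + j, k)%:R / 'C(k + j, k)%:R).

Definition hoggatt_transform (R : realType) (d : nat) (a : nat -> R) (n : nat)
    : R :=
  \sum_(0 <= k < n.+1) hoggatt R d n k * a k.

(* Main.v *)
Require Import Defs.
From mathcomp Require Import all_boot all_order all_algebra.
From mathcomp Require Import reals.
From mathcomp Require Import zify ring lra.

Set Implicit Arguments.
Unset Strict Implicit.
Unset Printing Implicit Defensive.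

Import Order.TTheory GRing.Theory Num.Theory.

Local Open Scope ring_scope.

(** Write T(n, k) for the Hoggatt numbers and c for the transform of a.  The
    triple of indices (n, n+1, n+2) is handled by spreading the three sums
    c_n, c_(n+1), c_(n+2) over the index set 0 <= k <= n of the first one, so
    that the inequality holds for each k separately; Cauchy-Schwarz then
    reassembles the sums.

    Each T(n+1, k) is shared between its two parents T(n, k) and T(n, k-1) in
    the proportion (n+1-k) : k, as in the classical binomial case, which gives
      (n+1) c_(n+1) = sum_k Q_k,
      Q_k = (n+1-k) T(n+1, k) a_k + (k+1) T(n+1, k+1) a_(k+1).
    With P_k = T(n, k) a_k, expanding Q_k^2 / P_k suggests the quantity
      R_k = (n+1-k) (n+1-k+d) T(n+2, k) a_k
            + 2 (n+1-k) (k+1) T(n+2, k+1) a_(k+1)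
            + (k+1) (k+1+d) T(n+2, k+2) a_(k+2).
    The Hoggatt numbers have the form V_n / (V_k V_(n-k)) up to a constant,
    with (n+1) V_n V_(n+2) = (n+1+d) V_(n+1)^2 ([superfact_ratio]).  Through
    this relation the first two terms of P_k R_k match those of Q_k^2 exactly, and
    the third does so up to a_(k+1)^2 <= a_k a_(k+2); this is
    (n+1+d) Q_k^2 <= (n+1) P_k R_k ([local_ineq]).

    It remains to see that the R_k do not overspend c_(n+2): the total
    coefficient received by T(n+2, k) a_k is at most (n+1) (n+1+d)
    ([share_bound], [hoggatt_transform_lower]).  The two sides differ by d-1
    for 0 < k < n+2 and agree at the two ends, so this is where d >= 1
    enters. *)

(** * A Cauchy-Schwarz inequality for sums *)

(** The hypotheses say that [[p, x], [x, r]] is positive semidefinite, a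
    condition that is stable under sums. *)
Lemma sqr_le_mulD (R : realFieldType) (x y p r p' r' : R) :
  0 <= p -> 0 <= r -> 0 <= p' -> 0 <= r' ->
  x ^+ 2 <= p * r -> y ^+ 2 <= p' * r' ->
  (x + y) ^+ 2 <= (p + p') * (r + r').
Proof.
move=> p0 r0 p'0 r'0 hx hy.
have cross : 2 * (x * y) <= p * r' + p' * r.
  apply: le_trans (ler_norm _) _.
  rewrite -ler_sqr ?nnegrE ?normr_ge0 ?addr_ge0 ?mulr_ge0 // real_normK ?num_real //.
  have : x ^+ 2 * y ^+ 2 <= (p * r) * (p' * r') by rewrite ler_pM ?sqr_ge0.
  have : 0 <= (p * r' - p' * r) ^+ 2 by rewrite sqr_ge0.
  lra.
lra.
Qed.

Lemma sqr_sum_le (R : realFieldType) (n : nat) (P Q S : nat -> R) :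
  (forall k, (k < n)%N -> [/\ 0 <= P k, 0 <= S k & Q k ^+ 2 <= P k * S k]) ->
  (\sum_(0 <= k < n) Q k) ^+ 2 <=
    (\sum_(0 <= k < n) P k) * (\sum_(0 <= k < n) S k).
Proof.
elim: n => [|n IHn] h; first by rewrite !big_geq // mulr0 expr0n.
rewrite !big_nat_recr //=.
have [P0 S0 hn] := h n (ltnSn n).
have h' k : (k < n)%N -> [/\ 0 <= P k, 0 <= S k & Q k ^+ 2 <= P k * S k].
  by move=> kn; apply: h; apply: ltnW.
apply: sqr_le_mulD => //; last exact: IHn.
- by rewrite big_nat; apply: sumr_ge0 => k /h'[].
- by rewrite big_nat; apply: sumr_ge0 => k /h'[].
Qed.

(** * Hoggatt numbers as generalized binomial coefficients *)

Definition superfact (R : realType) (d n : nat) : R :=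
  \prod_(0 <= j < d) (n + j)`!%:R.

Lemma superfact_gt0 (R : realType) d n : 0 < superfact R d n.
Proof. by apply: prodr_gt0 => j _; rewrite ltr0n fact_gt0. Qed.

Lemma superfact_ratio (R : realType) d n :
  n.+1%:R * (superfact R d n * superfact R d n.+2) =
  (n.+1 + d)%:R * superfact R d n.+1 ^+ 2.
Proof.
rewrite /superfact; elim: d => [|d IHd].
  by rewrite !big_geq // addn0 expr1n !mulr1.
rewrite !big_nat_recr //= !addSn !factS !natrM.
set U0 := \prod_(0 <= j < d) _ in IHd *.
set U2 := \prod_(0 <= j < d) _ in IHd *.
set U1 := \prod_(0 <= j < d) _ in IHd *.
set f := ((n + d)`!)%:R.
transitivity (n.+1%:R * (U0 * U2) * (f ^+ 2 * (n + d).+1%:R * (n + d).+2%:R)).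
  by ring.
by rewrite IHd addnS addSn; ring.
Qed.

Lemma hoggattE (R : realType) d k l :
  hoggatt R d (k + l) k =
  superfact R d 0 * superfact R d (k + l) /
    (superfact R d k * superfact R d l).
Proof.
rewrite /hoggatt /superfact -!big_split /= -prodf_div.
apply: eq_bigr => j _; rewrite add0n.
have nz m : (m`!)%:R != 0 :> R by rewrite pnatr_eq0 -lt0n fact_gt0.
have binE a b : 'C(a + b, a)%:R = (a + b)`!%:R / (a`!%:R * b`!%:R) :> R.
  rewrite -(@bin_fact (a + b) a) ?leq_addr // addKn natrM natrM mulfK //.
  by rewrite mulf_neq0.
by rewrite -addnA !binE; field; rewrite !nz.
Qed.

Lemma hoggatt_ge0 (R : realType) d n k : 0 <= hoggatt R d n k.
Proof. by apply: prodr_ge0 => j _; rewrite divr_ge0. Qed.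

(** After clearing the factors V_k and V_l, each identity follows from
    [superfact_ratio] at n; when k or l moves by two, [superfact_ratio] at that
    index gives the factor k+1 or l+1. *)
Lemma hoggatt_ratios (R : realType) d k l (n := (k + l)%N) :
  [/\ n.+1%:R * (l.+1 + d)%:R * (hoggatt R d n k * hoggatt R d n.+2 k) =
        (n.+1 + d)%:R * l.+1%:R * hoggatt R d n.+1 k ^+ 2,
      n.+1%:R * (hoggatt R d n k * hoggatt R d n.+2 k.+1) =
        (n.+1 + d)%:R * (hoggatt R d n.+1 k * hoggatt R d n.+1 k.+1) &
      n.+1%:R * (k.+1 + d)%:R * (hoggatt R d n k * hoggatt R d n.+2 k.+2) =
        (n.+1 + d)%:R * k.+1%:R * hoggatt R d n.+1 k.+1 ^+ 2].
Proof.
have U m : superfact R d m != 0 by rewrite gt_eqF ?superfact_gt0.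
have S m : (m.+1 + d)%:R = m.+1%:R * (superfact R d m * superfact R d m.+2) /
                             superfact R d m.+1 ^+ 2 :> R.
  by rewrite superfact_ratio mulfK // expf_neq0.
have e1 : n.+1 = (k + l.+1)%N by rewrite addnS.
have e1' : n.+1 = (k.+1 + l)%N by rewrite addSn.
have e2 : n.+2 = (k + l.+2)%N by rewrite !addnS.
have e2' : n.+2 = (k.+1 + l.+1)%N by rewrite addSn addnS.
have e2'' : n.+2 = (k.+2 + l)%N by rewrite !addSn.
have H0 : hoggatt R d n k = _ := hoggattE R d k l.
have H1 : hoggatt R d n.+1 k = superfact R d 0 * superfact R d n.+1 /
    (superfact R d k * superfact R d l.+1) by rewrite e1 hoggattE.
have H1' : hoggatt R d n.+1 k.+1 = superfact R d 0 * superfact R d n.+1 /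
    (superfact R d k.+1 * superfact R d l) by rewrite e1' hoggattE.
have H2 : hoggatt R d n.+2 k = superfact R d 0 * superfact R d n.+2 /
    (superfact R d k * superfact R d l.+2) by rewrite e2 hoggattE.
have H2' : hoggatt R d n.+2 k.+1 = superfact R d 0 * superfact R d n.+2 /
    (superfact R d k.+1 * superfact R d l.+1) by rewrite e2' hoggattE.
have H2'' : hoggatt R d n.+2 k.+2 = superfact R d 0 * superfact R d n.+2 /
    (superfact R d k.+2 * superfact R d l) by rewrite e2'' hoggattE.
rewrite H0 H1 H1' H2 H2' H2'' !S -/n.
by split; field; rewrite !U.
Qed.

(** * The inequality for each index, and the bookkeeping of coefficients *)

(** By [hoggatt_ratios] the right side minus the left side collapses to
    (n+1+d) ((k+1) T(n+1, k+1))^2 (a_k a_(k+2) - a_(k+1)^2): the terms in a_k^2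
    and a_k a_(k+1) cancel.  Here n = k + l, so l+1 is the share n+1-k. *)
Lemma local_ineq (R : realType) d k l (a : nat -> R) (n := (k + l)%N) :
  0 <= a k -> a k.+1 ^+ 2 <= a k * a k.+2 ->
  (n.+1 + d)%:R *
    (l.+1%:R * hoggatt R d n.+1 k * a k
     + k.+1%:R * hoggatt R d n.+1 k.+1 * a k.+1) ^+ 2 <=
  n.+1%:R * (hoggatt R d n k * a k) *
    ((l.+1 * (l.+1 + d))%:R * hoggatt R d n.+2 k * a k
     + (2 * l.+1 * k.+1)%:R * hoggatt R d n.+2 k.+1 * a k.+1
     + (k.+1 * (k.+1 + d))%:R * hoggatt R d n.+2 k.+2 * a k.+2).
Proof.
move=> ak lc; have [] := @hoggatt_ratios R d k l; rewrite -/n !natrM.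
set t := hoggatt R d n k.
set u := hoggatt R d n.+1 k; set v := hoggatt R d n.+1 k.+1.
set x := hoggatt R d n.+2 k; set y := hoggatt R d n.+2 k.+1.
set z := hoggatt R d n.+2 k.+2.
set N := n.+1%:R; set M := (n.+1 + d)%:R; set L := l.+1%:R; set K := k.+1%:R.
set L' := (l.+1 + d)%:R; set K' := (k.+1 + d)%:R => Ex Ey Ez.
have -> : N * (t * a k) *
    (L * L' * x * a k + 2 * L * K * y * a k.+1 + K * K' * z * a k.+2) =
    L * (N * L' * (t * x)) * a k ^+ 2
    + 2 * L * K * (N * (t * y)) * (a k * a k.+1)
    + K * (N * K' * (t * z)) * (a k * a k.+2) by ring.
rewrite Ex Ey Ez -subr_ge0.
have -> : L * (M * L * u ^+ 2) * a k ^+ 2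
    + 2 * L * K * (M * (u * v)) * (a k * a k.+1)
    + K * (M * K * v ^+ 2) * (a k * a k.+2)
    - M * (L * u * a k + K * v * a k.+1) ^+ 2 =
    M * (K * v) ^+ 2 * (a k * a k.+2 - a k.+1 ^+ 2) by ring.
by rewrite mulr_ge0 ?subr_ge0 // mulr_ge0 ?sqr_ge0 // ler0n.
Qed.

(** The three summands are what T(n+2, k) a_k receives from the indices k, k-1
    and k-2.  Truncated subtraction makes exactly those summands vanish whose
    index lies outside 0 <= k <= n. *)
Lemma share_bound d n k : (1 <= d)%N -> (k <= n.+2)%N ->
  ((n.+1 - k) * (n.+1 - k + d) + 2 * (n.+2 - k) * k + k.-1 * (k.-1 + d)
   <= n.+1 * (n.+1 + d))%N.
Proof.
move=> d0; case: k => [|j] hj; first by rewrite !subn0; lia.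
move: hj; rewrite ltnS leq_eqVlt => /orP[/eqP -> | hj].
  by have -> : (n.+1 - n.+2 = 0)%N by [lia]; rewrite subnn /=; lia.
have [l ->] : exists l, n = (j + l)%N by exists (n - j)%N; lia.
have -> : ((j + l).+1 - j.+1 = l)%N by lia.
have -> : ((j + l).+2 - j.+1 = l.+1)%N by lia.
rewrite /=; nia.
Qed.

(** * Log-convexity of the transform *)

Lemma hoggatt_transform_split (R : realType) d (a : nat -> R) n :
  n.+1%:R * hoggatt_transform d a n.+1 =
  \sum_(0 <= k < n.+1)
    ((n - k).+1%:R * hoggatt R d n.+1 k * a k
     + k.+1%:R * hoggatt R d n.+1 k.+1 * a k.+1).
Proof.
rewrite big_split /=.
rewrite /hoggatt_transform mulr_sumr.
transitivity (\sum_(0 <= k < n.+2) ((n.+1 - k)%:R * hoggatt R d n.+1 k * a k)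
              + \sum_(0 <= k < n.+2) (k%:R * hoggatt R d n.+1 k * a k)).
  rewrite -big_split /= [LHS]big_nat [RHS]big_nat; apply: eq_bigr => k /= hk.
  by rewrite -{1}(@subnK k n.+1) // natrD; ring.
rewrite big_nat_recr //= subnn !mul0r addr0; congr (_ + _).
  rewrite [LHS]big_nat [RHS]big_nat; apply: eq_bigr => k /= hk.
  by rewrite subSn.
by rewrite big_nat_recl //= !mul0r add0r.
Qed.

Lemma hoggatt_transform_lower (R : realType) d (a : nat -> R) n :
  (1 <= d)%N -> (forall k, 0 <= a k) ->
  \sum_(0 <= k < n.+1)
    (((n - k).+1 * ((n - k).+1 + d))%:R * hoggatt R d n.+2 k * a k
     + (2 * (n - k).+1 * k.+1)%:R * hoggatt R d n.+2 k.+1 * a k.+1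
     + (k.+1 * (k.+1 + d))%:R * hoggatt R d n.+2 k.+2 * a k.+2)
  <= (n.+1 * (n.+1 + d))%:R * hoggatt_transform d a n.+2.
Proof.
move=> d0 a0.
have -> : \sum_(0 <= k < n.+1)
    (((n - k).+1 * ((n - k).+1 + d))%:R * hoggatt R d n.+2 k * a k
     + (2 * (n - k).+1 * k.+1)%:R * hoggatt R d n.+2 k.+1 * a k.+1
     + (k.+1 * (k.+1 + d))%:R * hoggatt R d n.+2 k.+2 * a k.+2) =
  \sum_(0 <= k < n.+3) ((n.+1 - k) * (n.+1 - k + d) + 2 * (n.+2 - k) * k
                        + k.-1 * (k.-1 + d))%:R * hoggatt R d n.+2 k * a k.
  under [RHS]eq_bigr => k _ do rewrite !natrD 4!mulrDl.
  rewrite !big_split /=; congr (_ + _ + _).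
  - (* the terms k = n+1 and k = n+2 vanish *)
    rewrite [RHS]big_nat_recr //= [X in _ = X + _]big_nat_recr //=.
    have -> : (n.+1 - n.+2 = 0)%N by lia.
    rewrite subnn !mul0n !mul0r !addr0 [LHS]big_nat [RHS]big_nat.
    by apply: eq_bigr => k /= hk; rewrite subSn.
  - (* the terms k = 0 and k = n+2 vanish *)
    rewrite [RHS]big_nat_recr //= [X in _ = X + _]big_nat_recl //=.
    rewrite subnn !muln0 mul0n !mul0r addr0 add0r [LHS]big_nat [RHS]big_nat.
    by apply: eq_bigr => k /= hk; rewrite subSS subSn.
  - (* the terms k = 0 and k = 1 vanish *)
    rewrite [RHS]big_nat_recl //= [X in _ = _ + X]big_nat_recl //=.
    by rewrite !mul0n !mul0r !add0r.
rewrite /hoggatt_transform mulr_sumr big_nat [leRHS]big_nat.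
apply: ler_sum => k /= hk; rewrite -mulrA ler_wpM2r ?mulr_ge0 ?hoggatt_ge0 //.
by rewrite ler_nat share_bound.
Qed.

Theorem theorem1p1 (R : realType) (d : nat) (hd : (1 <= d)%N)
  (a : nat -> R) (ha : log_convex a) :
  log_convex (hoggatt_transform d a).
Proof.
case: ha => a0 alc.
split=> [n|[//|n] _ /=].
  by apply: sumr_ge0 => k _; rewrite mulr_ge0 ?hoggatt_ge0.
have N0 : 0 < n.+1%:R :> R by rewrite ltr0n.
have M0 : 0 < (n.+1 + d)%:R :> R by rewrite ltr0n.
have D0 : 0 < (n.+1 * (n.+1 + d))%:R :> R by rewrite ltr0n.
rewrite -(ler_pM2l D0).
(* The ratio (n+1)/(n+1+d) of the local inequality is put on the R_k side. *)
have CS := @sqr_sum_le R n.+1 (fun k => hoggatt R d n k * a k)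
  (fun k => (n - k).+1%:R * hoggatt R d n.+1 k * a k
     + k.+1%:R * hoggatt R d n.+1 k.+1 * a k.+1)
  (fun k => n.+1%:R / (n.+1 + d)%:R *
    (((n - k).+1 * ((n - k).+1 + d))%:R * hoggatt R d n.+2 k * a k
     + (2 * (n - k).+1 * k.+1)%:R * hoggatt R d n.+2 k.+1 * a k.+1
     + (k.+1 * (k.+1 + d))%:R * hoggatt R d n.+2 k.+2 * a k.+2)).
have {}CS := CS _.
rewrite -hoggatt_transform_split -mulr_sumr in CS.
have c0 : 0 <= hoggatt_transform d a n.
  by apply: sumr_ge0 => k _; rewrite mulr_ge0 ?hoggatt_ge0.
have low := ler_wpM2l c0 (hoggatt_transform_lower n hd a0).
rewrite [leRHS]mulrCA; apply: le_trans low.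
have -> : (n.+1 * (n.+1 + d))%:R * hoggatt_transform d a n.+1 ^+ 2 =
    (n.+1 + d)%:R / n.+1%:R * (n.+1%:R * hoggatt_transform d a n.+1) ^+ 2.
  by rewrite natrM; field; rewrite nat1r gt_eqF.
rewrite mulrC -ler_pdivlMr ?divr_gt0 //; apply: le_trans (CS _) _; last first.
  by rewrite mulrCA invf_div mulrC mulrA.
move=> k kn; have {kn} [l ->] : exists l, n = (k + l)%N.
  by exists (n - k)%N; lia.
rewrite addKn; split.
- by rewrite mulr_ge0 ?hoggatt_ge0.
- by rewrite ?(divr_ge0, addr_ge0, mulr_ge0, hoggatt_ge0) ?ler0n.
- rewrite [leRHS]mulrCA [leRHS]mulrAC [X in _ <= X / _]mulrA ler_pdivlMr ?ltr0n //.
  rewrite [leLHS]mulrC.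
  by apply: local_ineq => //; apply: (alc k.+1).
Qed.
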